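(* Consider a branching random walk $(X,\mu)$ and three subsets $A_1, A_2 \subseteq A \subseteq X$ such that $A_1 \cap A_2 = \emptyset$. If there exists $z \in X$ such that $$\mathbb{P}^{\delta_z}\Big(\sum_{x \in A_1} \eta_n(x) > 0 \text{ for infinitely many } n,\ \lim_{n \to +\infty} \sum_{x \in A_2} \eta_n(x) = 0\Big) > 0,$$ then $\mathbf{q}(z,A_2) > \mathbf{q}(z,A)$, whence $\mathbf{q}(\cdot,A_2) > \mathbf{q}(\cdot,A)$. In particular, if $x\in X$ is such that $x \to z$, then $\mathbf{q}(x,A_2) > \mathbf{q}(x,A)$ provided that $\bar{\mathbf{q}}(y) > 0$ for every $y$ such that $x \to y$ (for instance, if $\mu_y(\mathbf{0}) > 0$ for all $y \in X$).
   Context: Branching random walk (BRW). Let $X$ be an at most countable set, $\mathbb{N}=\{0,1,2,\dots\}$, $S_X := \{f : X \to \mathbb{N} : \sum_{y} f(y) < \infty\}$ (a countable set, with the $\sigma$-algebra $2^{S_X}$), and let $\mu = \{\mu_x\}_{x \in X}$ be a family of probability measures on $S_X$. The (discrete-time) BRW $(X,\mu)$ is the Markov chain $\{\eta_n\}_{n \in \mathbb{N}}$, where $\eta_n(x)$ is the number of particles alive at $x$ at time $n$, with the following dynamics: each particle of generation $n$ at a site $x$ lives one unit of time, after which a function $f \in S_X$ is chosen at random according to $\mu_x$ and the particle is replaced by $f(y)$ particles at $y$, for all $y \in X$; the choices are independent for all particles. $\mathbb{P}^{\delta_x}$ is the law of the process started from one particle at $x$. $\mathbf{0}\in S_X$ is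 the zero function (no children). Paths. Let $m_{xy} := \sum_{f \in S_X} f(y)\mu_x(f)$. Write $x \to y$ if there are $n \in \mathbb{N}$ and $x = x_0, x_1, \dots, x_n = y$ in $X$ with $m_{x_i x_{i+1}} > 0$ for all $i = 0,\dots,n-1$ (in particular $x \to x$). Extinction probabilities. For $A \subseteq X$, $\mathbf{q}(x,A) := 1 - \mathbb{P}^{\delta_x}\big(\limsup_{n \to \infty} \sum_{y \in A} \eta_n(y) > 0\big)$, and $\bar{\mathbf{q}}(x) := \mathbf{q}(x,X)$. For vectors $\mathbf{u},\mathbf{v} \in [0,1]^X$, $\mathbf{u} \ge \mathbf{v}$ is the coordinatewise order and $\mathbf{u} > \mathbf{v}$ means $\mathbf{u} \ge \mathbf{v}$ and $\mathbf{u} \ne \mathbf{v}$. *)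

(* Defs.v *)
From HB Require Import structures.
From mathcomp Require Export all_boot all_order all_algebra finmap multiset.
From mathcomp Require Export all_classical all_reals all_analysis.
Export Order.TTheory GRing.Theory Num.Theory numFieldNormedType.Exports.

Set Implicit Arguments.
Unset Strict Implicit.
Unset Printing Implicit Defensive.

Local Open Scope classical_set_scope.
Local Open Scope ring_scope.

(* S_X: a finitely supported function f : X -> nat is a finite multiset of
   particles, f y being the number of particles at y. It carries the discrete
   sigma-algebra 2^{S_X}. *)
Definition config (X : countType) : Type := {mset X}%mset.

HB.instance Definition _ (X : countType) :=
  Countable.copy (config X) {fsfun X -> nat with 0%N}.
HB.instance Definition _ (X : countType) :=
  isPointed.Build (config X) mset0.
HB.instance Definition _ (X : countType) :=
  @isMeasurable.Build default_measure_display (config X)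
    discrete_measurable discrete_measurable0
    discrete_measurableC discrete_measurableU.

Identity Coercion multiset_of_config : config >-> multiset_of.

Definition no_particle (X : countType) : config X := mset0.

Definition one_particle (X : countType) (x : X) : config X := [mset x]%mset.

Definition particles_in (X : countType) (A : set X) (g : config X) : nat :=
  (\sum_(y <- finsupp g | y \in A) g y)%N.

Section BRW.
Context {R : realType} {X : countType}.
Variable mu : X -> probability (config X) R.

Definition mean_offspring (x y : X) : \bar R :=
  (\esum_(f in [set: config X]) ((f y)%:R%:E * mu x [set f]))%E.

Definition leads_to (x y : X) : Prop :=
  exists n (w : nat -> X), [/\ w 0%N = x, w n = y &
    forall i, (i < n)%N -> (0 < mean_offspring (w i) (w i.+1))%E].

(* Probability that generation g has h as its set of children: the k-th
   particle of g, whose site is the k-th entry of the sequence g (sites listed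
   with multiplicity), is replaced by F k; independence of the choices makes the
   probability of a family F the product of the probabilities. *)
Definition transition_prob (g h : config X) : \bar R :=
  (\esum_(F in [set F : {ffun 'I_(size g) -> config X} |
                 forall y, h y = (\sum_(k < size g) F k y)%N])
     \prod_(k < size g) mu (tnth (in_tuple g) k) [set F k])%E.

Context {d : measure_display} {Omega : measurableType d}.
Variable eta : nat -> Omega -> config X.

(* Under P, eta is a Markov chain started from one particle at x with transition
   probabilities transition_prob. The Markov property
   P(eta_{n+1} = g_{n+1} | eta_0 = g_0, ..., eta_n = g_n) = p(g_n, g_{n+1})
   is multiplied out, so that null histories need no convention. *)
Record BRW_from (x : X) (P : probability Omega R) : Prop := {
  BRW_measurable : forall n, measurable_fun [set: Omega] (eta n);
  BRW_start : P [set w | eta 0%N w = one_particle x] = 1%E;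
  BRW_markov : forall (n : nat) (g : nat -> config X),
    P [set w | forall i, (i <= n.+1)%N -> eta i w = g i] =
    (P [set w | forall i, (i <= n)%N -> eta i w = g i] *
     transition_prob (g n) (g n.+1))%E }.

Variable P : X -> probability Omega R.

Definition survival_event (A : set X) : set Omega :=
  [set w | (0 < limn_esup (fun n => ((particles_in A (eta n w))%:R : R)%:E))%E].

Definition extinction_prob (A : set X) (x : X) : R :=
  1 - fine (P x (survival_event A)).

End BRW.

(* Main.v *)
Require Import Defs.
From mathcomp Require Import measurable_realfun.

(** Write [q B x] as the probability that [B] is eventually deserted, started
    from [x]. If [B] is contained in [A], desertion of [A] entails desertion of
    [B]; the hypothesis at [z] says that, with positive probability, [A2] is
    deserted while [A1], hence [A], is visited infinitely often. Since this
    event [E] lies in the difference, [q A z < q A2 z]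
    ([extinction_prob_lt]).

    It remains to carry the positivity of the probability of [E] from [z] to a
    point [x] from which [z] can be reached. It is enough to do this along one
    edge ([positive_from_child]). If the mean number of children at [z] of a
    particle at [x] is positive, some offspring configuration [f] of positive
    probability has a particle at [z]. Given this offspring, the particles of
    [f] have independent progenies; with positive probability the one at [z]
    realizes [E] and all the others die out. As [E] depends only on the germ at
    infinity of the trajectory, it is then realized by the whole process.

    The independence of progenies is not part of the definition, which only
    gives the Markov chain on configurations. It is obtained by superposing, on
    product spaces, processes started from single particles: the sum has the
    law of the process started from the sum ([superpose_law]), and the law on
    finite histories determines the probability of every event on trajectories
    ([first_step_law]). The former rests on the algebraic branching property
    [progeny_cat] of the functional [progeny], the expectation of functions of
    the first generations. All the exchanges of sums and integrals that this
    takes are instances of Tonelli's theorem for one class of functionals,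
    [sigma_linear]. *)

Set Implicit Arguments.
Unset Strict Implicit.
Unset Printing Implicit Defensive.

Local Open Scope classical_set_scope.
Local Open Scope ring_scope.

(** * Positive countably additive functionals *)

Section SigmaLinear.
Context {R : realType}.
Local Open Scope ereal_scope.

(** The bound [<=] passes through suprema of finite sums for every [c]; applied
    to [c^-1] it gives the converse for finite positive [c]. *)
Lemma ge0_esumZl (T : choiceType) (c : \bar R) (f : T -> \bar R) :
  0 <= c -> (forall t, 0 <= f t) ->
  \esum_(t in [set: T]) (c * f t) = c * \esum_(t in [set: T]) f t.
Proof.
move=> c0 f0.
have le_scale b (g : T -> \bar R) : 0 <= b -> (forall t, 0 <= g t) ->
    \esum_(t in [set: T]) (b * g t) <= b * \esum_(t in [set: T]) g t.
  move=> b0 g0; apply: ge_ereal_sup => _ [A fA <-].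
  rewrite -ge0_mule_fsumr//; apply: lee_wpmul2l => //.
  by apply: ereal_sup_ubound; exists A.
apply/eqP; rewrite eq_le le_scale//=.
case: c c0 => [r| |//] c0.
- have [->|r0] := eqVneq r 0%R.
    by rewrite mul0e; apply: esum_ge0 => t _; rewrite mul0e.
  have rV : r^-1%:E * r%:E = 1 by rewrite -EFinM mulVf.
  have := @le_scale r^-1%:E (fun t => r%:E * f t).
  rewrite lee_fin invr_ge0 -lee_fin => /(_ c0 (fun t => mule_ge0 c0 (f0 t))).
  under eq_esum do rewrite muleA rV mul1e.
  move=> /(lee_wpmul2l c0); rewrite muleA -EFinM mulfV// mul1e.
  by [].
- have [f_eq0|] := pselect (forall t, f t = 0).
    under [X in _ * X]eq_esum do rewrite f_eq0.
    by rewrite esum1// mule0; apply: esum_ge0 => t _; rewrite f_eq0 mule0.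
  move=> /existsNP[t ft]; apply: (le_trans (leey _)); apply: esum_ge.
  exists [set t]; first by split => //; exact: finite_set1.
  by rewrite fsbig_set1 gt0_mulye// lt0e f0 andbT; exact/eqP.
Qed.

Lemma exchange_esum (T U : choiceType) (f : T -> U -> \bar R) :
  (forall t u, 0 <= f t u) ->
  \esum_(t in [set: T]) \esum_(u in [set: U]) f t u =
  \esum_(u in [set: U]) \esum_(t in [set: T]) f t u.
Proof.
move=> f0; rewrite !esum_esum//.
rewrite (reindex_esum ([set: U] `*`` fun=> [set: T]) _ (fun x => (x.2, x.1)))//.
split=> //=.
- by move=> [i1 i2] [j1 j2] /= _ _ [] -> ->.
- by move=> [i1 i2] _; exists (i2, i1).
Qed.

Lemma esum_indic (T : choiceType) (f : T -> \bar R) (u : T) :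
  (forall t, 0 <= f t) ->
  \esum_(t in [set: T]) (f t * (\1_[set t] u)%:E) = f u.
Proof.
move=> f0; rewrite -[RHS](esum_set1 (a := f))// [RHS]esum_mkcond.
apply: eq_esum => t _; rewrite indicE.
have [->|tu] := eqVneq t u; first by rewrite !in_set1 eqxx mule1.
by rewrite !in_set1 eq_sym (negbTE tu) mule0.
Qed.

(** Turns a sum over a countable type into a series, the form in which
    integration theory exchanges sums and integrals. *)
Lemma esum_pickle (T : countType) (f : T -> \bar R) :
  (forall t, 0 <= f t) ->
  \esum_(t in [set: T]) f t = \sum_(k <oo) oapp f 0 (@pickle_inv T k).
Proof.
move=> f0; have f'0 k : 0 <= oapp f 0 (@pickle_inv T k).
  by case: pickle_inv => /=.
rewrite nneseries_esumT//.
transitivity (\esum_(k in @choice.pickle T @` [set: T])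
    oapp f 0 (@pickle_inv T k)).
  rewrite esum_image; last by move=> a b _ _; apply: (pcan_inj choice.pickleK).
  by apply: eq_esum => t _; rewrite choice.pickleK_inv.
rewrite esum_mkcond; apply: eq_esum => k _; case: ifPn => // knot.
case E : (@pickle_inv T k) => [t|//]; case/negP: knot; rewrite inE.
by exists t => //; have := @choice.pickle_invK T k; rewrite /ocancel E.
Qed.

(** Functionals on [0, +oo]-valued functions to which Tonelli's theorem for
    countable sums applies. Integrals and iterated countable sums are both of
    this kind, hence can be exchanged and compared by the same lemmas. *)
Record sigma_linear (U : Type) (L : (U -> \bar R) -> \bar R) : Prop := {
  sigma_linear_ge0 : forall phi, (forall u, 0 <= phi u) -> 0 <= L phi;
  sigma_linearZ : forall c phi, 0 <= c -> (forall u, 0 <= phi u) ->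
    L (fun u => c * phi u) = c * L phi;
  sigma_linear_esum : forall (T : countType) (phi : T -> U -> \bar R),
    (forall t u, 0 <= phi t u) ->
    L (fun u => \esum_(t in [set: T]) phi t u) =
    \esum_(t in [set: T]) L (phi t) }.

(** On a countable type a function is the countable combination of the
    indicators of points, so [L] is determined by its values there. *)
Lemma sigma_linear_atoms (U : countType) (L : (U -> \bar R) -> \bar R) phi :
  sigma_linear L -> (forall u, 0 <= phi u) ->
  L phi = \esum_(v in [set: U]) (phi v * L (fun u => (\1_[set v] u)%:E)).
Proof.
move=> sL phi0.
transitivity (L (fun u => \esum_(v in [set: U]) (phi v * (\1_[set v] u)%:E))).
  by congr L; apply/funext => u; rewrite esum_indic.
rewrite (sigma_linear_esum sL); last first.
  by move=> v u; rewrite mule_ge0// lee_fin.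
by apply: eq_esum => v _; rewrite (sigma_linearZ sL)// => u; rewrite lee_fin.
Qed.

Lemma eq_sigma_linear (U : countType) (L M : (U -> \bar R) -> \bar R) :
  sigma_linear L -> sigma_linear M ->
  (forall v : U, L (fun u => (\1_[set v] u)%:E) =
                 M (fun u => (\1_[set v] u)%:E)) ->
  forall phi, (forall u, 0 <= phi u) -> L phi = M phi.
Proof.
move=> sL sM LM phi phi0; rewrite (sigma_linear_atoms sL)//.
by rewrite (sigma_linear_atoms sM)//; apply: eq_esum => v _; rewrite LM.
Qed.

(** The preimage of any set is a countable union of fibres of [h]. *)
Lemma measurable_fun_countable d (Omega : measurableType d) (U : countType)
    (h : Omega -> U) (phi : U -> \bar R) :
  (forall u, measurable (h @^-1` [set u])) ->
  measurable_fun [set: Omega] (fun w => phi (h w)).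
Proof.
move=> mh _ Y _; rewrite setTI.
have -> : (fun w => phi (h w)) @^-1` Y =
    \bigcup_(u in [set: U])
      (if phi u \in Y then h @^-1` [set u] else set0).
  apply/seteqP; split => [w Yw|w [u _]] /=.
    by exists (h w) => //; rewrite mem_set.
  by case: ifPn => [|_ []]; rewrite inE => Yu /= ->.
by apply: countable_bigcupT_measurable => // u; case: ifP.
Qed.

Lemma sigma_linear_integral d (Omega : measurableType d) (U : countType)
    (mu : {measure set Omega -> \bar R}) (h : Omega -> U) :
  (forall u, measurable (h @^-1` [set u])) ->
  sigma_linear (fun phi => \int[mu]_w phi (h w)).
Proof.
move=> mh; split => [phi phi0|c phi c0 phi0|T phi phi0].
- exact: integral_ge0.
- by rewrite ge0_integralZl//; exact: measurable_fun_countable.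
- rewrite esum_pickle; last by move=> t; exact: integral_ge0.
  transitivity (\int[mu]_w
      \sum_(k <oo) oapp (fun t => phi t (h w)) 0 (@pickle_inv T k)).
    by apply: eq_integral => w _; rewrite esum_pickle.
  rewrite integral_nneseries//.
  + apply: eq_eseriesr => k _; case: pickle_inv => //=; exact: integral0.
  + move=> k; case: pickle_inv => [t|] /=; last exact: measurable_cst.
    exact: measurable_fun_countable.
  + by move=> k w _; case: pickle_inv => /=.
Qed.

End SigmaLinear.

(** * Expectations of one and of several generations *)

Section OffspringLaw.
Context {R : realType} {X : countType}.
Variable mu : X -> probability (config X) R.
Local Open Scope ereal_scope.
Implicit Types (s t : seq X) (phi : config X -> \bar R).

(** The expectation of [phi] at the sum of independent offspring of the
    particles listed in [s]. Parents form a sequence, not a configuration, so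
    that superposing two populations is concatenation. *)
Fixpoint offspring s phi : \bar R :=
  if s is x :: s' then
    \esum_(a in [set: config X])
      (mu x [set a] * offspring s' (fun b => phi (a `+` b)%mset))
  else phi mset0.

(** The expectation of [phi] at generations [1, ..., n] of the process started
    from [s]. The recursion is on the first generation, which makes the
    first-step decomposition hold by definition; generation [0] is left out
    because it is known. *)
Fixpoint progeny (n : nat) s (phi : seq (config X) -> \bar R) : \bar R :=
  if n is m.+1 then
    offspring s (fun a => progeny m a (fun h => phi (a :: h)))
  else phi [::].

Lemma sigma_linear_offspring s : sigma_linear (offspring s).
Proof.
elim: s => [|x s [IH0 IHZ IHe]]; split => //=.
- by move=> phi phi0; apply: esum_ge0 => a _; rewrite mule_ge0// IH0.
- move=> c phi c0 phi0; rewrite -ge0_esumZl// => [|a]; last first.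
    by rewrite mule_ge0// IH0.
  by apply: eq_esum => a _; rewrite IHZ// muleCA.
- move=> T phi phi0; rewrite exchange_esum => [|t a]; last first.
    by rewrite mule_ge0// IH0.
  apply: eq_esum => a _; rewrite IHe// ge0_esumZl// => t.
  exact: IH0.
Qed.

Lemma sigma_linear_progeny n s : sigma_linear (progeny n s).
Proof.
elim: n s => [|n IH] s; first by split => /= [phi ->||].
have [T0 TZ Te] := sigma_linear_offspring s; split => /=.
- by move=> phi phi0; apply: T0 => a; apply: (sigma_linear_ge0 (IH a)).
- move=> c phi c0 phi0; rewrite -TZ// => [|a]; last first.
    exact: (sigma_linear_ge0 (IH a)).
  by congr offspring; apply/funext => a; rewrite (sigma_linearZ (IH a)).
- move=> T phi phi0; rewrite -Te => [|t a]; last first.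
    exact: (sigma_linear_ge0 (IH a)).
  by congr offspring; apply/funext => a; rewrite (sigma_linear_esum (IH a)).
Qed.

(** Tonelli: [offspring] is built from countable sums only, each of which goes
    through [L]. *)
Lemma offspring_exchange (U : Type) (L : (U -> \bar R) -> \bar R) s
    (phi : U -> config X -> \bar R) :
  sigma_linear L -> (forall u a, 0 <= phi u a) ->
  L (fun u => offspring s (phi u)) = offspring s (fun a => L (phi^~ a)).
Proof.
move=> sL; elim: s phi => [//|x s IH] phi phi0 /=.
have T0 := sigma_linear_ge0 (sigma_linear_offspring s).
rewrite (sigma_linear_esum sL) => [|a u]; last by rewrite mule_ge0// T0.
apply: eq_esum => a _; rewrite (sigma_linearZ sL)// => [|u]; last exact: T0.
by rewrite IH.
Qed.

Lemma offspring_cat s t phi :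
  offspring (s ++ t) phi =
  offspring s (fun a => offspring t (fun b => phi (a `+` b)%mset)).
Proof.
elim: s phi => [|x s IH] phi /=.
  by congr offspring; apply/funext => b; rewrite mset0D.
apply: eq_esum => a _; rewrite IH; congr (_ * offspring s _).
apply/funext => b; congr offspring; apply/funext => c.
by rewrite msetDA.
Qed.

(** Independent offspring can be added in any order: exchanging two blocks of
    parents is an instance of Tonelli, and this moves any parent to the
    front. *)
Lemma offspring_perm s t phi : (forall a, 0 <= phi a) -> perm_eq s t ->
  offspring s phi = offspring t phi.
Proof.
have catC r r' psi : (forall a, 0 <= psi a) ->
    offspring (r ++ r') psi = offspring (r' ++ r) psi.
  move=> psi0; rewrite !offspring_cat offspring_exchange//; last first.
    exact: sigma_linear_offspring.
  congr offspring; apply/funext => b; congr offspring; apply/funext => a.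
  by rewrite msetDC.
elim: s t phi => [|x s IH] t phi phi0 st.
  by move: st; rewrite perm_sym => /perm_nilP ->.
have /path.splitPr tE : x \in t by rewrite -(perm_mem st) mem_head.
case: tE st => t1 t2; rewrite perm_sym perm_catC/= perm_cons perm_catC perm_sym.
move=> st; rewrite catC//= [RHS]/=; apply: eq_esum => a _.
by rewrite (IH (t1 ++ t2))// catC.
Qed.

Definition add_history (h k : seq (config X)) : seq (config X) :=
  [seq (p.1 `+` p.2)%mset | p <- zip h k].

Lemma perm_enum_msetD (a b : config X) :
  perm_eq (enum_mset (a `+` b)%mset) (enum_mset a ++ enum_mset b).
Proof.
apply/allP => x _ /=; rewrite count_cat !count_mem_mset.
by rewrite msetE2.
Qed.

Lemma progeny_perm n s t (phi : seq (config X) -> \bar R) :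
  (forall h, 0 <= phi h) -> perm_eq s t ->
  progeny n s phi = progeny n t phi.
Proof.
case: n => //= n phi0; apply: offspring_perm => a.
exact: (sigma_linear_ge0 (sigma_linear_progeny n a)).
Qed.

(** The branching property: the process started from [s ++ t] is the sum of
    independent processes started from [s] and from [t]. By induction on [n],
    the only step being to exchange the later generations of the first process
    with the first generation of the second. *)
Lemma progeny_cat n s t (phi : seq (config X) -> \bar R) :
  (forall h, 0 <= phi h) ->
  progeny n (s ++ t) phi =
  progeny n s (fun h => progeny n t (fun k => phi (add_history h k))).
Proof.
elim: n s t phi => //= n IH s t phi phi0; rewrite offspring_cat.
congr offspring; apply/funext => a.
have p0 := sigma_linear_ge0 (sigma_linear_progeny n _).
rewrite (offspring_exchange _ (sigma_linear_progeny n a)) => [|h b]; last first.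
  exact: p0.
congr offspring; apply/funext => b.
by rewrite (progeny_perm _ _ (perm_enum_msetD a b))// IH.
Qed.

End OffspringLaw.

(** * Comparison with the transition probabilities *)

Section Chain.
Context {R : realType} {X : countType}.
Variable mu : X -> probability (config X) R.
Local Open Scope ereal_scope.

(** Choosing a family of offspring for [x :: s] is choosing one for [x] and a
    family for [s]. *)
Lemma esum_families (s : seq X) (phi : config X -> \bar R) :
  (forall a, 0 <= phi a) ->
  \esum_(F in [set: {ffun 'I_(size s) -> config X}])
    ((\prod_(k < size s) mu (tnth (in_tuple s) k) [set F k]) *
     phi (\big[msetD/mset0]_(k < size s) F k)) = offspring mu s phi.
Proof.
elim: s phi => [|x s IH] phi phi0 /=.
  have -> : [set: {ffun 'I_0 -> config X}] = [set [ffun=> mset0]].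
    by apply/seteqP; split => // F _; apply/ffunP => -[].
  by rewrite esum_set1 !big_ord0 ?mul1e.
(* [e (a, G)] gives [a] to the first parent and [G j] to parent [j + 1]. *)
pose e (p : config X * {ffun 'I_(size s) -> config X}) :
    {ffun 'I_(size s).+1 -> config X} :=
  [ffun k => if unlift ord0 k is Some j then p.2 j else p.1].
rewrite (reindex_esum ([set: config X] `*`` (fun=> setT)) _ e); last first.
  split => // [[a G] [b G'] _ _ /ffunP epq|F _].
    congr pair.
      by have := epq ord0; rewrite !ffunE unlift_none.
    by apply/ffunP => j; have := epq (lift ord0 j); rewrite !ffunE liftK.
  exists (F ord0, [ffun j => F (lift ord0 j)]) => //.
  apply/ffunP => k; rewrite ffunE; case: unliftP => [j ->|-> //].
  by rewrite ffunE.
have prod0 n (t : 'I_n -> X) (G : 'I_n -> config X) :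
    0 <= \prod_(k < n) mu (t k) [set G k].
  by elim/big_ind: _ => // a b a0 b0; exact: mule_ge0.
rewrite -(esum_esum (a := fun a G => \prod_(k < (size s).+1)
    mu (tnth (in_tuple (x :: s)) k) [set e (a, G) k] *
    phi (\big[msetD/mset0]_(k < (size s).+1) e (a, G) k))); last first.
  by move=> a G _ _; rewrite mule_ge0.
apply: eq_esum => a _; rewrite -IH// -ge0_esumZl// => [|G]; last first.
  by rewrite mule_ge0.
apply: eq_esum => G _; rewrite !big_ord_recl !ffunE unlift_none/= -muleA.
rewrite [tnth _ _](tnth_nth x)/=; congr (_ * (_ * phi (_ `+` _)%mset)).
  by apply: eq_bigr => k _; rewrite ffunE liftK !(tnth_nth x).
by apply: eq_bigr => k _; rewrite ffunE liftK.
Qed.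

Lemma transition_probE (g h : config X) :
  transition_prob mu g h = offspring mu g (fun a => (\1_[set h] a)%:E).
Proof.
rewrite -esum_families => [|a]; last by rewrite lee_fin.
rewrite /transition_prob esum_mkcond; apply: eq_esum => F _; rewrite indicE.
have -> : (\big[msetD/mset0]_(k < size g) F k \in [set h]) =
    (F \in [set F : {ffun 'I_(size g) -> config X} |
              forall y, h y = (\sum_(k < size g) F k y)%N]).
  have sumE y : (\big[msetD/mset0]_(k < size g) F k : {mset X}%mset) y =
      (\sum_(k < size g) F k y)%N.
    apply: (big_morph (fun a : {mset X}%mset => a y)) => [a b|].
      by rewrite msetE2.
    by rewrite mset0E.
  apply/idP/idP; rewrite !inE /=.
    by move=> <- y.
  by move=> hF; apply/msetP => y; rewrite hF sumE.
by case: ifP; rewrite ?mule1 ?mule0.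
Qed.

Fixpoint history_weight (g : config X) (h : seq (config X)) : \bar R :=
  if h is b :: h' then transition_prob mu g b * history_weight b h' else 1.

Lemma history_weight_rcons g h b :
  history_weight g (rcons h b) =
  history_weight g h * transition_prob mu (last g h) b.
Proof.
by elim: h g => [|c h IH] g /=; rewrite ?mule1 ?mul1e// IH muleA.
Qed.

(** The indicator of [b :: h] is a product, whose factor at the first
    generation selects [b]; the default [0] accounts for histories of the
    wrong length. *)
Lemma progeny_point n (g : config X) (h : seq (config X)) :
  progeny mu n g (fun k => (\1_[set h] k)%:E) =
  if size h == n then history_weight g h else 0.
Proof.
have progeny0 m (a : config X) : progeny mu m a (fun=> 0) = 0.
  under [fun=> 0]eq_fun do rewrite -(mul0e 1).
  by rewrite (sigma_linearZ (sigma_linear_progeny mu m a))// mul0e.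
have offspring0 (a : config X) : offspring mu a (fun=> 0) = 0.
  under [fun=> 0]eq_fun do rewrite -(mul0e 1).
  by rewrite (sigma_linearZ (sigma_linear_offspring mu a))// mul0e.
elim: n g h => [|n IH] g [|b h] /=; rewrite ?indicE.
- by rewrite mem_set.
- by rewrite memNset.
- under eq_fun => a.
    under eq_fun do rewrite indicE memNset//.
    rewrite progeny0.
    over.
  exact: offspring0.
- under eq_fun => a.
    rewrite (_ : (fun k => _) = fun k => (\1_[set b] a)%:E * (\1_[set h] k)%:E).
      rewrite (sigma_linearZ (sigma_linear_progeny mu n a))//.
      rewrite IH (_ : _ * _ = (if size h == n then history_weight b h else 0) *
        (\1_[set b] a)%:E).
        over.
      rewrite indicE; have [|_] := boolP (a \in [set b]); last first.
        by rewrite mul0e mule0.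
      by rewrite inE => ->; rewrite muleC.
    apply/funext => k; rewrite !indicE -EFinM -natrM mulnb.
    congr ((nat_of_bool _)%:R%:E).
    by apply/idP/andP => [|[]]; rewrite !inE => -[-> ->].
  rewrite (sigma_linearZ (sigma_linear_offspring mu g))//; last first.
    case: ifP => // _; elim: h b {IH} => //= c h IH b; rewrite mule_ge0//.
    rewrite transition_probE.
    exact: (sigma_linear_ge0 (sigma_linear_offspring mu b)).
  rewrite -transition_probE eqSS muleC.
  by case: ifP; rewrite ?mule0.
Qed.

End Chain.

(** * Processes with the branching law, and their superposition *)

Section BranchingLaw.
Context {R : realType} {X : countType}.
Variable mu : X -> probability (config X) R.
Local Open Scope ereal_scope.

Definition history {Omega : Type} (eta : nat -> Omega -> config X) (n : nat)
  (w : Omega) : seq (config X) := mkseq (fun i => eta i.+1 w) n.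

(** The law is recorded through expectations of functions of finite histories
    rather than through cylinder probabilities: with this form the law of a
    superposition follows from Tonelli. Generation [0] is left out, since [s]
    plays its role in the law of the others. *)
Record branching_law {d} {Omega : measurableType d}
    (eta : nat -> Omega -> config X) (s : seq X) (Q : probability Omega R) :
    Prop := {
  law_measurable : forall n (H : set (config X)),
    measurable (eta n @^-1` H);
  law_history : forall n (phi : seq (config X) -> \bar R),
    (forall h, 0 <= phi h) ->
    \int[Q]_w phi (history eta n w) = progeny mu n s phi }.

Lemma measurable_history d (Omega : measurableType d)
    (eta : nat -> Omega -> config X) :
  (forall n H, measurable (eta n @^-1` H)) ->
  forall n H, measurable (history eta n @^-1` H).
Proof.
move=> meta.
have m1 n h : measurable (history eta n @^-1` [set h]).
  elim: n h => [|n IH]; case/lastP => [|h b].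
  - rewrite (_ : _ @^-1` _ = setT)//; exact/seteqP.
  - rewrite (_ : _ @^-1` _ = set0)//; apply/seteqP; split => // w.
    by move=> /(congr1 size); rewrite size_rcons.
  - by rewrite (_ : _ @^-1` _ = set0)//; apply/seteqP; split.
  - rewrite (_ : _ @^-1` _ =
        history eta n @^-1` [set h] `&` eta n.+1 @^-1` [set b]).
      exact: measurableI.
    apply/seteqP; split => w /=; rewrite /history mkseqS.
      by move=> /rcons_inj [-> ->].
    by move=> [-> ->].
move=> n H.
rewrite (_ : _ @^-1` _ =
    \bigcup_(h in [set: seq (config X)])
      (if h \in H then history eta n @^-1` [set h] else set0)).
  by apply: countable_bigcupT_measurable => // h; case: ifP.
apply/seteqP; split => [w Hw|w [h _]] /=.
  by exists (history eta n w) => //; rewrite mem_set.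
by case: ifPn => [|_ []]; rewrite inE => Hh /= ->.
Qed.

Lemma law_history_event d (Omega : measurableType d)
    (eta : nat -> Omega -> config X) (s : seq X) (Q : probability Omega R) :
  branching_law eta s Q ->
  forall n H, Q (history eta n @^-1` H) =
    progeny mu n s (fun h => (\1_H h)%:E).
Proof.
move=> [meta law] n H; rewrite -law => [|h]; last by rewrite lee_fin.
rewrite -[in LHS](setIT (_ @^-1` H)) -integral_indic//.
exact: measurable_history.
Qed.

Section FromBRW.
Context {d : measure_display} {Omega : measurableType d}.
Variables (eta : nat -> Omega -> config X) (x : X) (P : probability Omega R).
Hypothesis brw : BRW_from mu eta x P.

Lemma measurable_BRW_preimage n H : measurable (eta n @^-1` H).
Proof.
by rewrite -[X in measurable X]setTI; apply: (BRW_measurable brw).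
Qed.

Lemma BRW_history_prob n (g : nat -> config X) : g 0%N = one_particle x ->
  P [set w | forall i, (i <= n)%N -> eta i w = g i] =
  history_weight mu (g 0%N) (mkseq (fun i => g i.+1) n).
Proof.
move=> g0; elim: n => [|n IH].
  rewrite /= -(BRW_start brw) -g0; congr (P _); apply/seteqP; split => w /=.
    by apply.
  by move=> e0 i; rewrite leqn0 => /eqP ->.
rewrite (BRW_markov brw) IH mkseqS history_weight_rcons; congr (_ * _).
congr (transition_prob mu _ _); case: n {IH} => [//|n].
by rewrite mkseqS last_rcons.
Qed.

(** Both sides are sigma-linear in [phi], so only single histories have to be
    compared; for these the Markov property yields the product of transition
    probabilities. *)
Lemma BRW_law : branching_law eta (one_particle x) P.
Proof.
have meta := measurable_BRW_preimage; split => //= n.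
apply: eq_sigma_linear.
- by apply: sigma_linear_integral => h; exact: measurable_history.
- exact: sigma_linear_progeny.
move=> h; rewrite progeny_point.
rewrite (integral_indic P measurableT (A := history eta n @^-1` [set h]));
  last first.
  exact: measurable_history.
rewrite setIT; case: ifP => [/eqP sh|/negP sh]; last first.
  rewrite (_ : _ @^-1` _ = set0)//; apply/seteqP; split => // w /= e.
  by apply: sh; rewrite -e size_mkseq.
pose g i := nth (one_particle x) (one_particle x :: h) i.
have gh : mkseq (fun i => g i.+1) n = h.
  by rewrite -[RHS](mkseq_nth (one_particle x)) sh.
rewrite -[in RHS]gh -(@BRW_history_prob n g)//.
set C := [set w | _].
have mC : measurable C.
  rewrite (_ : C = \bigcap_(i in [set i | (i <= n)%N]) eta i @^-1` [set g i]).
    by apply: bigcap_measurable => [|i _]; [exists 0%N|exact: meta].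
  by apply/seteqP; split => w /= Cw i; exact: Cw.
have CE : C = history eta n @^-1` [set h] `&`
    eta 0%N @^-1` [set one_particle x].
  apply/seteqP; split => w /= => [Cw|[hw e0] [|i] le_in].
  - split; last exact: (Cw 0%N).
    rewrite -gh; apply/eq_in_map => i; rewrite mem_iota => /andP[_ lt_in].
    exact: Cw.
  - exact: e0.
  - rewrite -gh in hw.
    have := congr1 (fun k => nth (one_particle x) k i) hw.
    by rewrite !nth_mkseq.
(* The initial condition holds almost surely, so it may be dropped. *)
have P_start0 : P (~` (eta 0%N @^-1` [set one_particle x])) = 0.
  by rewrite probability_setC// (BRW_start brw) subee.
apply/eqP; rewrite eq_le; apply/andP; split.
  rewrite (@le_trans _ _ (P (C `|` ~` (eta 0%N @^-1` [set one_particle x]))))//.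
    apply: le_measure; rewrite ?inE//.
    - exact: measurable_history.
    - by apply: measurableU => //; apply: measurableC.
    - move=> w hw; rewrite CE.
      have [e0|] := pselect ((eta 0%N @^-1` [set one_particle x]) w).
        by left.
      by right.
  rewrite (le_trans (measureU2 _ _ _))//; first exact: measurableC.
  by rewrite [X in _ + X]P_start0 adde0.
apply: le_measure; rewrite ?inE//; first exact: measurable_history.
by rewrite CE => w [].
Qed.

End FromBRW.

Section Superposition.
Context {d1 d2 : measure_display} {O1 : measurableType d1}
  {O2 : measurableType d2}.
Variables (eta1 : nat -> O1 -> config X) (eta2 : nat -> O2 -> config X).

Definition superpose (n : nat) (w : O1 * O2) : config X :=
  (eta1 n w.1 `+` eta2 n w.2)%mset.

Lemma history_superpose n w :
  history superpose n w = add_history (history eta1 n w.1) (history eta2 n w.2).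
Proof.
rewrite /add_history /history /mkseq zip_map -map_comp.
by apply: eq_map.
Qed.

(** Tonelli for the product measure, read on finite histories, is the
    branching property. *)
Lemma superpose_law s t (P : probability O1 R) (Q : probability O2 R) :
  branching_law eta1 s P -> branching_law eta2 t Q ->
  branching_law superpose (s ++ t) (P \x Q).
Proof.
move=> [m1 law1] [m2 law2]; have meas n H : measurable (superpose n @^-1` H).
  rewrite (_ : _ @^-1` _ =
      \bigcup_(a in [set: config X])
        ((eta1 n @^-1` [set a]) `*`
         (eta2 n @^-1` [set b | H (a `+` b)%mset]))).
    apply: countable_bigcupT_measurable => // a.
    by apply: measurableX; [exact: m1|exact: m2].
  apply/seteqP; split => [w Hw|w [a _ [/= <-]]] //=.
  by exists (eta1 n w.1).
split => // n phi phi0; rewrite fubini_tonelli1//; last first.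
  by apply: measurable_fun_countable => h; exact: measurable_history.
rewrite progeny_cat// -law1 => [|h]; last first.
  exact: (sigma_linear_ge0 (sigma_linear_progeny _ _ _)).
apply: eq_integral => w1 _; rewrite /fubini_F -law2//.
by apply: eq_integral => w2 _; rewrite history_superpose.
Qed.

End Superposition.

End BranchingLaw.

(** * Events on trajectories and the first step *)

Section Trajectories.
Context {R : realType} {X : countType}.
Variable mu : X -> probability (config X) R.
Local Open Scope ereal_scope.

(** Conditions on a finite history, of arbitrary form: this makes the family
    stable under intersection, as the uniqueness theorem for measures needs. *)
Definition cylinders : set (set (nat -> config X)) :=
  [set C | exists n (H : set (seq (config X))), C = [set p | H (mkseq p n)]].

Definition trajectory {Omega : Type} (eta : nat -> Omega -> config X)
  (w : Omega) : nat -> config X := fun n => eta n w.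

Lemma setI_closed_cylinders : setI_closed cylinders.
Proof.
have widen n N (H : set (seq (config X))) : (n <= N)%N ->
    [set p | H (mkseq p n)] = [set p | H (take n (mkseq p N))].
  move=> nN; apply: eq_set => p; congr H.
  by rewrite /mkseq -map_take take_iota (minn_idPl nN).
move=> _ _ [n [H ->]] [m [K ->]].
exists (maxn n m), [set h | H (take n h) /\ K (take m h)].
by rewrite (widen _ _ H (leq_maxl n m)) (widen _ _ K (leq_maxr n m)).
Qed.

Lemma measurable_trajectory d (Omega : measurableType d)
    (eta : nat -> Omega -> config X) :
  (forall n H, measurable (eta n @^-1` H)) ->
  measurable_fun [set: Omega]
    (trajectory eta : Omega -> g_sigma_algebraType cylinders).
Proof.
move=> meta; apply: (@measurability _ _ _ (g_sigma_algebraType cylinders)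
  _ _ cylinders erefl).
move=> _ [_ [n [H ->]] <-]; rewrite setTI.
(* Histories start at time 1, hence the delayed process. *)
exact: (@measurable_history _ _ _ (fun n => eta n.-1)).
Qed.

Lemma preimage_trajectory d (Omega : measurableType d)
    (eta : nat -> Omega -> config X) (E : set (nat -> config X)) :
  (forall n H, measurable (eta n @^-1` H)) -> <<s cylinders >> E ->
  measurable (trajectory eta @^-1` E).
Proof.
move=> meta mE; rewrite -[X in measurable X]setTI.
exact: (measurable_trajectory meta).
Qed.

(** The Markov property at time 1 for events on the whole future. Both sides
    are finite measures in [E] that agree on cylinders, by the first-step
    decomposition of [progeny]. *)
Lemma first_step_law d1 (O1 : measurableType d1)
    (eta : nat -> O1 -> config X) s (P : probability O1 R)
    d2 (O2 : measurableType d2) (zeta : nat -> O2 -> config X)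
    (f : config X) (Q : probability O2 R) (E : set (nat -> config X)) :
  branching_law mu eta s P -> branching_law mu zeta f Q ->
  <<s cylinders >> E ->
  P (trajectory (fun n => eta n.+2) @^-1` E `&` eta 1%N @^-1` [set f]) =
  offspring mu s (fun a => (\1_[set f] a)%:E) *
  Q (trajectory (fun n => zeta n.+1) @^-1` E).
Proof.
move=> lP lQ mE.
have [meta _] := lP; have [mzeta _] := lQ.
have progeny_consE n H :
    progeny mu n.+1 s (fun h => (\1_[set f :: k | k in H] h)%:E) =
    offspring mu s (fun a => (\1_[set f] a)%:E) *
    progeny mu n f (fun h => (\1_H h)%:E).
  rewrite /= muleC -(sigma_linearZ (sigma_linear_offspring mu s)) => //;
    last first.
    apply: (sigma_linear_ge0 (sigma_linear_progeny _ _ _)) => h.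
    by rewrite lee_fin.
  congr offspring; apply/funext => a.
  have [->|af] := eqVneq a f.
    rewrite [\1_[set f] f]indicE mem_set// mule1; congr progeny.
    apply/funext => h; rewrite !indicE; congr ((nat_of_bool _)%:R%:E).
    by apply/idP/idP; rewrite !inE; [case=> k Hk [<-]|exists h].
  rewrite [\1_[set f] a]indicE memNset; last exact/eqP.
  rewrite mule0 -[RHS](mul0e (progeny mu n a (fun=> 0))).
  rewrite -(sigma_linearZ (sigma_linear_progeny mu n a))//.
  congr progeny; apply/funext => h.
  rewrite mul0e indicE memNset// => -[k _ [fa _]].
  by move/eqP: af; apply.
have step1 H n : P (trajectory (fun n => eta n.+2) @^-1` [set p | H (mkseq p n)]
      `&` eta 1%N @^-1` [set f]) =
    offspring mu s (fun a => (\1_[set f] a)%:E) *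
    Q (trajectory (fun n => zeta n.+1) @^-1` [set p | H (mkseq p n)]).
  rewrite [in RHS](law_history_event lQ n H) -progeny_consE.
  rewrite -(law_history_event lP).
  congr (P _); apply/seteqP; split => w /=.
    move=> [Hw fw]; exists (mkseq (trajectory (fun n => eta n.+2) w) n) => //.
    rewrite /history /mkseq/= -[in RHS]add1n iotaDl -map_comp fw.
    by congr cons; apply: eq_map.
  move=> [k Hk]; rewrite /history /mkseq/= -[in iota 1 n]add1n iotaDl -map_comp.
  by move=> [<-] kE; split => //; rewrite -kE in Hk *.
set c := offspring _ _ _ in step1 *.
have mA : measurable (eta 1%N @^-1` [set f]) by exact: meta.
have c0 : 0 <= c.
  apply: (sigma_linear_ge0 (sigma_linear_offspring _ _)) => a.
  by rewrite lee_fin.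
(* [c] is the probability that the first generation is [f]. *)
have c_fin : c = (fine c)%:E.
  rewrite fineK// ge0_fin_numE//.
  have := step1 setT 0%N.
  rewrite [X in _ = c * Q X](_ : _ = setT); last exact/seteqP.
  rewrite [X in P (X `&` _)](_ : _ = setT); last exact/seteqP.
  rewrite probability_setT mule1 setTI => <-.
  exact: le_lt_trans (probability_le1 P mA) (ltry _).
have fc0 : (0 <= fine c)%R by exact: fine_ge0.
pose T := g_sigma_algebraType cylinders.
have mt1 := measurable_trajectory (fun n => meta n.+2).
have mt2 := measurable_trajectory (fun n => mzeta n.+1).
pose m1 := measure_function_pushforward__canonical__measure_function_Measure
  (measure_function_mrestr__canonical__measure_function_Measure P mA) mt1.
pose m2 := measure_function_mscale__canonical__measure_function_Measure
  (NngNum fc0)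
  (measure_function_pushforward__canonical__measure_function_Measure Q mt2).
suff : m1 E = m2 E by rewrite /m1 /m2 /= /mscale /pushforward /mrestr/= -c_fin.
apply: (@measure_unique _ R T cylinders (fun=> setT) erefl
  setI_closed_cylinders _ _ m1 m2 _ _ E mE) => //.
- by move=> _; exists 0%N, setT.
- by rewrite bigcup_const.
- move=> _ [n [H ->]].
  by rewrite /m1 /m2 /= /mscale /pushforward /mrestr/= -c_fin step1.
- move=> _; rewrite /m1/= /pushforward/mrestr/=.
  rewrite preimage_setT setTI.
  exact: le_lt_trans (probability_le1 P mA) (ltry _).
Qed.

End Trajectories.

(** * Germ events and the positivity of their probabilities *)

Section Events.
Context {R : realType} {X : countType}.
Variable mu : X -> probability (config X) R.
Local Open Scope ereal_scope.
Implicit Types (A : set X) (E : set (nat -> config X)).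

Definition eventually_in (H : set (config X)) : set (nat -> config X) :=
  [set p | exists N, forall n, (N <= n)%N -> H (p n)].

Definition empty_on A : set (config X) := [set g | particles_in A g = 0%N].

(** Events that depend only on the germ of the trajectory at infinity, up to a
    shift of time: they are insensitive both to dropping the first generations
    and to the addition of a population that dies out. *)
Definition germ_event E : Prop :=
  forall p p' N k, (forall n, (N <= n)%N -> p n = p' (n + k)%N) ->
  E p <-> E p'.

Lemma germ_shift E p k : germ_event E -> E (fun n => p (k + n)%N) <-> E p.
Proof. by move=> gE; apply: (gE _ _ 0%N k) => n _; rewrite addnC. Qed.

Lemma measurable_eventually_in H : <<s cylinders >> (eventually_in H).
Proof.
pose T : measurableType _ := g_sigma_algebraType (@cylinders X).
have mH n : measurable ([set p : T | H (p n)]).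
  apply: sub_sigma_algebra; exists n.+1, [set h | H (nth mset0 h n)].
  by apply: eq_set => p /=; rewrite nth_mkseq.
suff : measurable (\bigcup_N \bigcap_(n in [set n | (N <= n)%N])
    [set p : T | H (p n)]).
  congr measurable; apply/seteqP; split => p.
    by move=> [N _ Np]; exists N.
  by move=> [N Np]; exists N.
apply: bigcupT_measurable => N; apply: bigcap_measurable => //.
by exists N => /=.
Qed.

Lemma germ_eventually_in H : germ_event (eventually_in H).
Proof.
move=> p p' N k pp'; split => -[M HM].
  exists (maxn N M + k)%N => n; have [nk|kn] := leqP k n; last first.
    by rewrite leqNgt (leq_trans kn (leq_addl _ _)).
  rewrite -(subnK nk) leq_add2r geq_max => /andP[Nn Mn].
  by rewrite -pp'//; exact: HM.
exists (maxn N M) => n; rewrite geq_max => /andP[Nn Mn].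
by rewrite pp'//; apply: HM; rewrite (leq_trans Mn)// leq_addr.
Qed.

Lemma sigma_cylindersI (E F : set (nat -> config X)) :
  <<s cylinders >> E -> <<s cylinders >> F -> <<s cylinders >> (E `&` F).
Proof.
pose T : measurableType _ := g_sigma_algebraType (@cylinders X).
exact: (@measurableI _ T).
Qed.

Lemma sigma_cylindersC E : <<s cylinders >> E -> <<s cylinders >> (~` E).
Proof.
pose T : measurableType _ := g_sigma_algebraType (@cylinders X).
exact: (@measurableC _ T).
Qed.

Lemma germ_eventI (E F : set (nat -> config X)) :
  germ_event E -> germ_event F -> germ_event (E `&` F).
Proof.
move=> gE gF p p' N k pp'; have [E1 E2] := gE _ _ _ _ pp'.
have [F1 F2] := gF _ _ _ _ pp'.
by split => -[Ep Fp]; split; auto.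
Qed.

Lemma germ_eventC E : germ_event E -> germ_event (~` E).
Proof.
move=> gE p p' N k pp'; have [E1 E2] := gE _ _ _ _ pp'.
by split; apply: contra_not.
Qed.

Lemma empty_onT : empty_on setT = [set no_particle X].
Proof.
apply/seteqP; split => g /=; last first.
  by move=> ->; apply: big1_seq => y _; exact: mset0E.
rewrite /empty_on/= /particles_in => g0.
apply/eqP; rewrite -[_ == _]size_mset_eq0 size_mset -[X in _ == X]g0.
by apply/eqP/eq_bigl => y; rewrite in_setT.
Qed.

Lemma empty_onS A A' : A `<=` A' -> empty_on A' `<=` empty_on A.
Proof.
move=> AA' g /eqP; rewrite sum_nat_seq_eq0 => /allP g0.
apply/eqP; rewrite sum_nat_seq_eq0; apply/allP => y yg.
apply/implyP => yA; have /implyP := g0 y yg; apply.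
by move: yA; rewrite !inE; exact: AA'.
Qed.

Lemma law_perm d (O : measurableType d) (eta : nat -> O -> config X)
    (s t : seq X) (Q : probability O R) :
  perm_eq s t -> branching_law mu eta s Q -> branching_law mu eta t Q.
Proof.
move=> st [meta law]; split => // n phi phi0.
by rewrite law//; exact: progeny_perm.
Qed.

Lemma empty_law d (O : measurableType d) (Q : probability O R) :
  branching_law mu (fun=> cst (no_particle X)) [::] Q.
Proof.
split => [n H|n phi phi0].
  by rewrite preimage_cst; case: ifP.
have -> : progeny mu n [::] phi = phi (nseq n mset0).
  by elim: n phi phi0 => //= n IH phi phi0; rewrite enum_mset0 IH.
have hE w : history (fun=> cst (no_particle X)) n w = nseq n mset0.
  apply/(@eq_from_nth _ mset0); rewrite size_mkseq ?size_nseq// => i lt_in.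
  by rewrite nth_mkseq// nth_nseq if_same.
under eq_integral do rewrite hE.
by rewrite integral_cst// -[RHS]mule1; congr (_ * _); exact: probability_setT.
Qed.

Lemma offspring_point1 (x : X) (f : config X) :
  offspring mu (one_particle x) (fun a => (\1_[set f] a)%:E) = mu x [set f].
Proof.
rewrite enum_msetn /= -[RHS](@esum_indic _ _ (fun a => mu x [set a]) f)//.
apply: eq_esum => a _; rewrite msetD0 !indicE.
congr (_ * (nat_of_bool _)%:R%:E).
by rewrite !in_set1 eq_sym.
Qed.

Section Family.
Context {d : measure_display} {Omega : measurableType d}.
Variables (eta : nat -> Omega -> config X) (P : X -> probability Omega R).
Hypothesis brw : forall x, BRW_from mu eta x (P x).

Lemma measurable_BRW_event (x : X) E : <<s cylinders >> E ->
  measurable (trajectory eta @^-1` E).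
Proof.
by apply: preimage_trajectory; exact: (measurable_BRW_preimage (brw x)).
Qed.

(** If the first generation is [f] and its progeny realizes [E], then so does
    the whole trajectory, as [E] ignores a shift of time. *)
Lemma children_bound x (f : config X) d' (O : measurableType d')
    (zeta : nat -> O -> config X) (Q : probability O R) E :
  branching_law mu zeta f Q -> <<s cylinders >> E -> germ_event E ->
  mu x [set f] * Q (trajectory zeta @^-1` E) <= P x (trajectory eta @^-1` E).
Proof.
move=> lQ mE gE; have meta := measurable_BRW_preimage (brw x).
have -> : trajectory zeta @^-1` E =
    trajectory (fun n => zeta n.+1) @^-1` E.
  apply/seteqP; split => w.
    exact: (germ_shift (trajectory zeta w) 1 gE).2.
  exact: (germ_shift (trajectory zeta w) 1 gE).1.
rewrite -offspring_point1 -(first_step_law (BRW_law (brw x)) lQ mE).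
apply: le_measure; rewrite ?inE.
- apply: measurableI => //.
  by apply: preimage_trajectory => // n H; exact: meta.
- exact: preimage_trajectory.
- by move=> w [Ew _]; exact: (germ_shift (trajectory eta w) 2 gE).1.
Qed.

Let extinct := eventually_in [set no_particle X].

(** Add the particles of [s] one at a time, on product spaces: with positive
    probability the new particle has an extinct progeny, independently of the
    others, and then the sum has the same germ as before. *)
Lemma extinct_company s t d' (O : measurableType d')
    (zeta : nat -> O -> config X) (Q : probability O R) E :
  (forall y, y \in s -> 0 < P y (trajectory eta @^-1` extinct)) ->
  branching_law mu zeta t Q -> <<s cylinders >> E -> germ_event E ->
  0 < Q (trajectory zeta @^-1` E) ->
  exists (d'' : measure_display) (O' : measurableType d'')
    (zeta' : nat -> O' -> config X) (Q' : probability O' R),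
    branching_law mu zeta' (s ++ t) Q' /\ 0 < Q' (trajectory zeta' @^-1` E).
Proof.
move=> ext lQ mE gE QE; elim: s ext => [_|y s IH ext].
  by exists d', O, zeta, Q.
case: IH => [u us|d2 [U2 [zeta2 [Q2 [lQ2 Q2E]]]]].
  by apply: ext; rewrite inE us orbT.
exists _, _, (superpose eta zeta2), (P y \x Q2); split.
  have : perm_eq (one_particle y ++ (s ++ t)) ((y :: s) ++ t).
    by rewrite enum_msetn.
  move/law_perm; apply; exact: (superpose_law (BRW_law (brw y)) lQ2).
have mext := measurable_BRW_event y
  (measurable_eventually_in [set no_particle X]).
have [mzeta2 _] := lQ2; have mE2 := preimage_trajectory mzeta2 mE.
have : 0 < (P y \x Q2) ((trajectory eta @^-1` extinct) `*`
                       (trajectory zeta2 @^-1` E)).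
  rewrite product_measure1E// mule_gt0//; apply: ext; exact: mem_head.
move=> /lt_le_trans; apply; apply: le_measure; rewrite ?inE.
- exact: measurableX.
- apply: preimage_trajectory => //.
  by have [] := superpose_law (BRW_law (brw y)) lQ2.
- move=> [w1 w2] [/= [N extN]] Ew2.
  apply: (gE (trajectory zeta2 w2) _ N 0%N _).1 Ew2 => n Nn.
  by rewrite addn0 /trajectory /superpose/= [eta n w1]extN// mset0D.
Qed.

(** With positive probability the children of [x] form [f], one child at [z]
    realizes [E] and the progenies of all the other children die out. *)
Lemma positive_from_child (x : X) (f : config X) (z : X) E :
  0 < mu x [set f] -> (0 < f z)%N ->
  (forall y, (0 < f y)%N -> 0 < P y (trajectory eta @^-1` extinct)) ->
  <<s cylinders >> E -> germ_event E ->
  0 < P z (trajectory eta @^-1` E) -> 0 < P x (trajectory eta @^-1` E).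
Proof.
move=> muf zf ext mE gE PzE.
have memf y : (y \in enum_mset f) = (0 < f y)%N.
  by rewrite -has_pred1 has_count count_mem_mset.
case: (extinct_company (s := rem z (enum_mset f)) _ (BRW_law (brw z)) mE gE PzE)
  => [y ys|d' [U [zeta [Q [lQ QE]]]]].
  by apply: ext; rewrite -memf; move/mem_rem : ys.
have : perm_eq (rem z (enum_mset f) ++ one_particle z) f.
  by rewrite enum_msetn perm_catC/= perm_sym perm_to_rem// memf.
move=> /law_perm/(_ lQ) {}lQ.
by apply: lt_le_trans (children_bound x lQ mE gE); rewrite mule_gt0.
Qed.

End Family.
End Events.

(** * Paths, survival and extinction probabilities *)

Section Reachability.
Context {R : realType} {X : countType}.
Variable mu : X -> probability (config X) R.
Context {d : measure_display} {Omega : measurableType d}.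
Variables (eta : nat -> Omega -> config X) (P : X -> probability Omega R).
Hypothesis brw : forall x, BRW_from mu eta x (P x).
Local Open Scope ereal_scope.

Lemma mean_offspring_gt0 x y :
  0 < mean_offspring mu x y <->
  exists f : config X, 0 < mu x [set f] /\ (0 < f y)%N.
Proof.
have term0 (f : config X) : 0 <= (f y)%:R%:E * mu x [set f].
  by rewrite mule_ge0// lee_fin.
split => [|[f [muf fy]]].
  apply: contraPP => /forallNP noF; apply/negP; rewrite -leNgt.
  rewrite /mean_offspring esum1// => f _.
  have [->|fy] := posnP (f y); first by rewrite mul0e.
  have [|muf] := pselect (0 < mu x [set f]); first by move=> muf; case: (noF f).
  suff -> : mu x [set f] = 0 by rewrite mule0.
  by apply/eqP; rewrite eq_le measure_ge0 andbT leNgt; exact/negP.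
apply: (@lt_le_trans _ _ ((f y)%:R%:E * mu x [set f])).
  by rewrite mule_gt0// lte_fin ltr0n.
apply: esum_ge; exists [set f]; first by split => //; exact: finite_set1.
by rewrite fsbig_set1.
Qed.

(** Along a path from [x] to [z], one edge at a time: every site reachable from
    the second vertex is reachable from [x], so extinction keeps a positive
    probability at all the sites concerned. *)
Lemma positive_from_ancestor x z (E : set (nat -> config X)) :
  leads_to mu x z ->
  (forall y, leads_to mu x y ->
     0 < P y (trajectory eta @^-1` eventually_in [set no_particle X])) ->
  <<s cylinders >> E -> germ_event E ->
  0 < P z (trajectory eta @^-1` E) -> 0 < P x (trajectory eta @^-1` E).
Proof.
move=> [n [w [w0 wn edges]]] ext mE gE PzE.
elim: n x w w0 wn edges ext => [|n IH] x w w0 wn edges ext.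
  by rewrite -w0 wn.
have cons_path y u : 0 < mean_offspring mu x u -> leads_to mu u y ->
    leads_to mu x y.
  move=> xu [m [v [v0 vm vedges]]].
  exists m.+1, (fun i => if i is j.+1 then v j else x); split => // -[_|i].
    by rewrite v0.
  exact: vedges.
have xw1 : 0 < mean_offspring mu x (w 1%N) by rewrite -w0 edges.
have [f [muf fw]] := (mean_offspring_gt0 x (w 1%N)).1 xw1.
apply: (positive_from_child brw muf fw _ mE gE).
  move=> y fy; apply: ext; apply: (cons_path _ y).
    by apply/mean_offspring_gt0; exists f.
  by exists 0%N, (fun=> y); split.
apply: (IH _ (fun i => w i.+1)) => // [i lt_in|y w1y]; first exact: edges.
by apply: ext; exact: cons_path w1y.
Qed.

(** A sequence of natural numbers has a positive upper limit exactly when it is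
    not eventually zero. *)
Lemma survival_eventE (A : set X) :
  survival_event (R := R) eta A =
  ~` (trajectory eta @^-1` eventually_in (empty_on A)).
Proof.
apply/seteqP; split => w /=.
  rewrite /survival_event/=; apply: contraPnot => -[N AN]; apply/negP.
  rewrite -leNgt.
  have cvg0 : (fun n => (particles_in A (eta n w))%:R%:E : \bar R) @ \oo --> 0.
    apply: cvg_near_cst; exists N => // n /= Nn.
    by rewrite [particles_in _ _]AN.
  rewrite is_cvg_limn_esupE; first by rewrite (cvg_lim _ cvg0).
  by apply/cvg_ex; exists 0.
move=> io; rewrite /survival_event/= (@lt_le_trans _ _ 1)//.
apply/ereal_infP => _ [V [N _ NV] <-].
have [n [Nn An]] : exists n, (N <= n)%N /\ (0 < particles_in A (eta n w))%N.
  apply: contrapT => /forallNP noN; apply: io; exists N => n Nn.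
  by apply/eqP; rewrite -leqn0 leqNgt; apply/negP => An; case: (noN n).
apply: (@le_trans _ _ (particles_in A (eta n w))%:R%:E).
  by rewrite lee_fin ler1n.
by apply: ereal_sup_ubound; exists n => //; exact: NV.
Qed.

Lemma extinction_probE (A : set X) x :
  (extinction_prob eta P A x)%:E =
  P x (trajectory eta @^-1` eventually_in (empty_on A)).
Proof.
have mA := measurable_BRW_event brw x (measurable_eventually_in (empty_on A)).
rewrite /extinction_prob survival_eventE probability_setC//.
by rewrite -(fineK (fin_num_measure (P x) _ mA))/= subKr.
Qed.

(** Desertion of [A] and the event [F] are disjoint parts of the desertion of
    [B]. *)
Lemma extinction_prob_lt (A B : set X) x (F : set Omega) :
  B `<=` A -> measurable F -> 0 < P x F ->
  F `<=` trajectory eta @^-1` (eventually_in (empty_on B) `\`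
                               eventually_in (empty_on A)) ->
  (extinction_prob eta P A x < extinction_prob eta P B x)%R.
Proof.
move=> BA mF PF FBA; rewrite -lte_fin !extinction_probE.
have meas C := measurable_BRW_event brw x
  (measurable_eventually_in (empty_on C)).
set EA := _ @^-1` _; set EB := _ @^-1` _.
have mEA : measurable EA by exact: meas.
apply: (@lt_le_trans _ _ (P x (EA `|` F))).
  rewrite measureU//; last first.
    by apply/seteqP; split => // w [EAw Fw]; have [_] := FBA w Fw; apply.
  by rewrite lteDl// fin_num_measure.
apply: le_measure; rewrite ?inE//; [exact: measurableU|exact: meas|].
move=> w [[N AN]|/FBA []//]; exists N => n Nn.
by apply: (empty_onS BA); exact: AN.
Qed.

Lemma extinction_prob_le (A B : set X) x : B `<=` A ->
  (extinction_prob eta P A x <= extinction_prob eta P B x)%R.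
Proof.
move=> BA; rewrite -lee_fin !extinction_probE.
have meas C := measurable_BRW_event brw x
  (measurable_eventually_in (empty_on C)).
apply: le_measure; rewrite ?inE; [exact: meas|exact: meas|].
move=> w [N AN]; exists N => n Nn.
by apply: (empty_onS BA); exact: AN.
Qed.

(** Having no child is a first step to the empty population, whose law is that
    of the null process. *)
Lemma extinction_prob_gt0 y : 0 < mu y [set no_particle X] ->
  (0 < extinction_prob eta P [set: X] y)%R.
Proof.
move=> muy; rewrite -lte_fin extinction_probE empty_onT.
have lQ : branching_law mu (fun=> cst (no_particle X))
    (enum_mset (no_particle X)) (P y).
  by rewrite enum_mset0; exact: empty_law.
apply: lt_le_trans (children_bound brw y lQ (measurable_eventually_in _)
  (@germ_eventually_in _ _)).
rewrite mule_gt0//.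
rewrite [X in P y X](_ : _ = setT) ?probability_setT//.
by apply/seteqP; split => // w _; exists 0%N.
Qed.

End Reachability.

Theorem lemma2p5 (R : realType) (X : countType)
    (mu : X -> probability (config X) R)
    (d : measure_display) (Omega : measurableType d)
    (eta : nat -> Omega -> config X) (P : X -> probability Omega R)
    (brw : forall x, BRW_from mu eta x (P x))
    (A1 A2 A : set X) (sA1 : A1 `<=` A) (sA2 : A2 `<=` A)
    (dA : A1 `&` A2 = set0) :
  let q B x := extinction_prob eta P B x in
  (forall z : X,
     (0 < P z [set w |
       (forall N : nat, exists n : nat,
          (N <= n)%N /\ (0 < particles_in A1 (eta n w))%N) /\
       ((particles_in A2 (eta n w))%:R : R) @[n --> \oo] --> 0%R ])%E ->
     [/\ q A z < q A2 z,
         (q A < q A2)%O &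
         forall x : X, leads_to mu x z ->
           (forall y, leads_to mu x y -> 0 < q [set: X] y) ->
           q A x < q A2 x]) /\
  ((forall y : X, (0 < mu y [set no_particle X])%E) ->
     forall y : X, 0 < q [set: X] y).
Proof.
move=> q; split=> [z|mu0 y]; last exact: (extinction_prob_gt0 brw).
pose E := ~` eventually_in (empty_on A1) `&` eventually_in (empty_on A2).
have mE : <<s cylinders >> E.
  apply: sigma_cylindersI; last exact: measurable_eventually_in.
  by apply: sigma_cylindersC; exact: measurable_eventually_in.
have gE : germ_event E.
  apply: germ_eventI; last exact: germ_eventually_in.
  by apply: germ_eventC; exact: germ_eventually_in.
rewrite (_ : [set w | _] = trajectory eta @^-1` E); last first.
  apply/seteqP; split => w /= -[io cvg0]; split.
  - move=> [N AN]; have [n [Nn]] := io N.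
    by rewrite [particles_in _ _]AN.
  - have /cvgrPdist_lt/(_ 1 ltr01)[N _ AN] := cvg0.
    exists N => n /AN; rewrite /= sub0r normrN ger0_norm// ltrn1 ltnS leqn0.
    by move/eqP.
  - move=> N; apply: contrapT => /forallNP noN; apply: io; exists N => n Nn.
    by apply/eqP; rewrite -leqn0 leqNgt; apply/negP => An; case: (noN n).
  - have [N AN] := cvg0; apply: cvg_near_cst; exists N => // n /= Nn.
    by rewrite [particles_in _ _]AN.
move=> PzE.
have lt_of x : (0 < P x (trajectory eta @^-1` E))%E -> q A x < q A2 x.
  move=> PxE; apply: (extinction_prob_lt brw sA2 _ PxE).
    exact: (measurable_BRW_event brw x).
  move=> w [A1w A2w]; split => // -[N AN]; apply: A1w; exists N => n Nn.
  by apply: (empty_onS sA1); exact: AN.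
split; first exact: lt_of.
- apply/asboolP; split => [x|]; first exact: (extinction_prob_le brw).
  by exists z; rewrite lt_eqF// lt_of.
- move=> x xz qx; apply: lt_of.
  apply: (positive_from_ancestor brw xz _ mE gE PzE).
  by move=> y /qx; rewrite -lte_fin (extinction_probE brw) empty_onT.
Qed.
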